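(* Let $R\hookrightarrow\mathcal{D}$ be a division $R$-ring of fractions. Assume that (1) $\operatorname{Tor}_1^R(\mathcal{D},\mathcal{D})=0$, and (2) for any finitely generated left or right $R$-submodule $M$ of $\mathcal{D}$ and any exact sequence $0\to J\to R^n\to M\to0$ of (left, respectively right) $R$-modules, the $R$-module $J$ is finitely generated stably free. Then $R$ is a pseudo-Sylvester domain and $\mathcal{D}$ is the universal division $R$-ring of fractions.
   Context: All rings are associative with unit, not necessarily commutative. An epic division $R$-ring is a division ring $\mathcal{D}$ with a ring homomorphism $R\to\mathcal{D}$ whose image generates $\mathcal{D}$ as a division ring; if the map is injective, it is called a division $R$-ring of fractions. A division $R$-ring of fractions $\mathcal{D}$ is the universal division $R$-ring of fractions if for any epic division $R$-ring $\mathcal{D}'$, every square matrix over $R$ that becomes invertible over $\mathcal{D}'$ becomes invertible over $\mathcal{D}$. A module $M$ over $R$ is stably free if $M\oplus R^n$ is free for some $n\ge0$. A ring $R$ is stably finite if for all $n$ and all $n\times n$ matrices $A,B$ over $R$, $AB=I_n$ implies $BA=I_n$. The inner rank $\rho(A)$ of an $m\times n$ matrix $A$ over $R$ is the least $k$ such that $A=BC$ with $B$ of size $m\times k$ and $C$ of size $k\times n$. The stable rank is $\rho^\ast(A)=\lim_{s\to\infty}[\rho(A\oplus I_s)-s]$ (well defined and non-negative over stably finite rings), where $A\oplus I_s$ is the block diagonal matrix with blocks $A$ and $I_s$. A non-zero ring $R$ is a pseudo-Sylvester domain if it is stably finite and for all $A\in\operatorname{Mat}_{m\times n}(R)$, $B\in\operatorname{Mat}_{n\times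 k}(R)$ with $AB=0$ one has $\rho^\ast(A)+\rho^\ast(B)\le n$. *)

(* Defs.v *)
From HB Require Import structures.
From mathcomp Require Import all_boot all_order all_algebra.
From mathcomp Require Import boolp classical_sets.
From mathcomp.multinomials Require Import freeg.

Set Implicit Arguments.
Unset Strict Implicit.
Unset Printing Implicit Defensive.

Import GRing.Theory Num.Theory.
Local Open Scope ring_scope.

(* Right R-modules are left modules over the converse ring R^c:               *)
(* the right action  a . r  is written  (r : R^c) *: a.                       *)

(******************************************************************************)
(*                         Epic division R-rings                              *)
(******************************************************************************)

(* For a possibly noncommutative unitRingType, GRing.field_axiom says exactly *)
(* that every nonzero element is invertible.                                  *)
Definition is_division_ring (D : unitRingType) : Prop := GRing.field_axiom D.

Definition epic_division_ring (R : nzRingType) (D : unitRingType)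
    (f : {rmorphism R -> D}) : Prop :=
  is_division_ring D /\
  (forall S : {pred D}, divring_closed S -> (forall r, f r \in S) ->
     forall x, x \in S).

Definition division_ring_of_fractions (R : nzRingType) (D : unitRingType)
    (f : {rmorphism R -> D}) : Prop :=
  epic_division_ring f /\ injective f.

(* unitmx is only available over commutative rings. *)
Definition invertible_mx (R : nzRingType) (n : nat) (A : 'M[R]_n) : Prop :=
  exists B : 'M[R]_n, A *m B = 1%:M /\ B *m A = 1%:M.

Definition universal_division_ring_of_fractions (R : nzRingType)
    (D : unitRingType) (f : {rmorphism R -> D}) : Prop :=
  division_ring_of_fractions f /\
  (forall (D' : unitRingType) (f' : {rmorphism R -> D'}),
     epic_division_ring f' ->
     forall (n : nat) (A : 'M[R]_n),
       invertible_mx (map_mx f' A) -> invertible_mx (map_mx f A)).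

Definition left_restriction (R : nzRingType) (D : unitRingType)
  (f : {rmorphism R -> D}) : Type := D.
Definition right_restriction (R : nzRingType) (D : unitRingType)
  (f : {rmorphism R -> D}) : Type := D.

Section Restriction.
Variables (R : nzRingType) (D : unitRingType) (f : {rmorphism R -> D}).

HB.instance Definition _ := GRing.Zmodule.on (left_restriction f).
HB.instance Definition _ := GRing.Zmodule.on (right_restriction f).

Let lscale (r : R) (x : left_restriction f) : left_restriction f :=
  f r * (x : D).
Let rscale (r : R^c) (x : right_restriction f) : right_restriction f :=
  (x : D) * f r.

Fact lscaleA a b v : lscale a (lscale b v) = lscale (a * b) v.
Proof. by rewrite /lscale rmorphM mulrA. Qed.
Fact lscale1 : left_id 1 lscale.
Proof. by move=> v; rewrite /lscale rmorph1 mul1r. Qed.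
Fact lscaleDr : right_distributive lscale +%R.
Proof. by move=> a u v; rewrite /lscale mulrDr. Qed.
Fact lscaleDl v : {morph lscale^~ v : a b / a + b}.
Proof. by move=> a b; rewrite /lscale rmorphD mulrDl. Qed.
HB.instance Definition _ := GRing.Zmodule_isLmodule.Build R
  (left_restriction f) lscaleA lscale1 lscaleDr lscaleDl.

Fact rscaleA a b v : rscale a (rscale b v) = rscale (a * b) v.
Proof. by rewrite /rscale -mulrA -rmorphM. Qed.
Fact rscale1 : left_id 1 rscale.
Proof. by move=> v; rewrite /rscale rmorph1 mulr1. Qed.
Fact rscaleDr : right_distributive rscale +%R.
Proof. by move=> a u v; rewrite /rscale mulrDl. Qed.
Fact rscaleDl v : {morph rscale^~ v : a b / a + b}.
Proof. by move=> a b; rewrite /rscale rmorphD mulrDr. Qed.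
HB.instance Definition _ := GRing.Zmodule_isLmodule.Build R^c
  (right_restriction f) rscaleA rscale1 rscaleDr rscaleDl.

Lemma left_restrictionE (r : R) (x : left_restriction f) :
  r *: x = f r * (x : D) :> D.
Proof. by []. Qed.

Lemma right_restrictionE (r : R) (x : right_restriction f) :
  (r : R^c) *: x = (x : D) * f r :> D.
Proof. by []. Qed.
End Restriction.

(******************************************************************************)
(*                 Finitely generated and stably free modules                 *)
(******************************************************************************)

Definition submodule_fg (R : nzRingType) (U : lmodType R) (M : {pred U}) :
    Prop :=
  exists (n : nat) (e : 'I_n -> U), (forall i, e i \in M) /\
    forall x, x \in M -> exists c : 'I_n -> R, x = \sum_i c i *: e i.

Definition module_fg (R : nzRingType) (U : lmodType R) : Prop :=
  submodule_fg (@predT U).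

Definition module_basis (R : nzRingType) (U : lmodType R) (B : {pred U}) :
    Prop :=
  (forall x, exists (s : seq U) (c : U -> R),
     {subset s <= B} /\ x = \sum_(b <- s) c b *: b) /\
  (forall (s : seq U) (c : U -> R), uniq s -> {subset s <= B} ->
     \sum_(b <- s) c b *: b = 0 -> forall b, b \in s -> c b = 0).

Definition module_free (R : nzRingType) (U : lmodType R) : Prop :=
  exists B : {pred U}, module_basis B.

Definition stably_free (R : nzRingType) (U : lmodType R) : Prop :=
  exists n : nat, module_free (U * 'rV[R]_n)%type.

(* Every presentation 0 -> J -> R^n -> M -> 0 of a finitely generated         *)
(* submodule M of U has J finitely generated stably free; p is the composite  *)
(* R^n -> M -> U. For S := R^c, 'rV[S]_n is the right R-module R^n.           *)
Definition stably_free_syzygies (S : nzRingType) (U : lmodType S) : Prop :=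
  forall M : {pred U}, submod_closed M -> submodule_fg M ->
  forall (n : nat) (J : lmodType S)
    (i : {linear J -> 'rV[S]_n}) (p : {linear 'rV[S]_n -> U}),
    injective i ->
    (forall v, p v = 0 <-> exists j, v = i j) ->
    (forall x, x \in M <-> exists v, x = p v) ->
    module_fg J /\ stably_free J.
Arguments stably_free_syzygies S U : clear implicits.

(******************************************************************************)
(*                            Tensor products                                 *)
(******************************************************************************)

Section Tensor.
Variables (R : nzRingType) (A : lmodType R^c) (B : lmodType R).

Definition balanced (G : zmodType) (h : A -> B -> G) : Prop :=
  [/\ forall a a' b, h (a + a') b = h a b + h a' b,
      forall a b b', h a (b + b') = h a b + h a b' &
      forall a (r : R) b, h ((r : R^c) *: a) b = h a (r *: b)].

Definition fpair (a : A) (b : B) : {freeg (A * B)} := << (a, b) >>.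

Definition tensor_relators (S : {pred {freeg (A * B)}}) : Prop :=
  [/\ forall a a' b, fpair (a + a') b - (fpair a b + fpair a' b) \in S,
      forall a b b', fpair a (b + b') - (fpair a b + fpair a b') \in S &
      forall a (r : R) b, fpair ((r : R^c) *: a) b - fpair a (r *: b) \in S].

(* The subgroup generated by the relators. *)
Definition tensor_relations : {pred {freeg (A * B)}} :=
  [pred x | `[< forall S : {pred {freeg (A * B)}},
                  zmod_closed S -> tensor_relators S -> x \in S >]].

Fact tensor_relations_closed : zmod_closed tensor_relations.
Proof.
split; first by apply/asboolP => S [].
move=> x y /asboolP hx /asboolP hy; apply/asboolP => S cS rS.
by apply: cS.2; [exact: hx | exact: hy].
Qed.
HB.instance Definition _ := GRing.isZmodClosed.Build {freeg (A * B)}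
  tensor_relations tensor_relations_closed.

Definition tensor : Type := Quotient.quot tensor_relations.
HB.instance Definition _ := GRing.Zmodule.on tensor.

Definition tens (a : A) (b : B) : tensor :=
  (\pi_(Quotient.quot tensor_relations) (fpair a b))%qT.

Definition tensor_lift (G : zmodType) (h : A -> B -> G) (x : tensor) : G :=
  fglift (fun ab : A * B => h ab.1 ab.2 : zmodule G)
    (repr (x : Quotient.quot tensor_relations)).

Lemma tensor_lift_pi (G : zmodType) (h : A -> B -> G) :
  balanced h -> forall x : {freeg (A * B)},
  tensor_lift h (\pi_(Quotient.quot tensor_relations) x)%qT =
  fglift (fun ab : A * B => h ab.1 ab.2 : zmodule G) x.
Proof.
move=> [hDl hDr hZ] x; rewrite /tensor_lift.
set q := Quotient.quot _; set F := fglift _.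
have addF : zmod_morphism F by exact: lift_is_additive.
have F0 : F 0 = 0 by have := addF 0 0; rewrite !subrr.
have FD u v : F (u + v) = F u + F v.
  have FN w : F (- w) = - F w by rewrite -[- w]add0r addF F0 sub0r.
  by rewrite -{1}[v]opprK addF FN opprK.
have Fp a b : F (fpair a b) = h a b by rewrite /F /fpair liftU scale1r.
have : repr (\pi_q x)%qT - x \in tensor_relations.
  by rewrite Quotient.idealrBE reprK.
move=> /asboolP /(_ [pred y | F y == 0]) -/(_ _ _)/eqP H.
apply/eqP; rewrite -subr_eq0 -addF; apply/eqP/H.
  split=> [|u v]; rewrite !inE ?F0 // addF => /eqP-> /eqP->.
  by rewrite subrr.
by split=> *; rewrite !inE addF ?FD !Fp ?hDl ?hDr ?hZ subrr.
Qed.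

Lemma tensor_lift_tens (G : zmodType) (h : A -> B -> G) a b :
  balanced h -> tensor_lift h (tens a b) = h a b.
Proof. by move=> hh; rewrite tensor_lift_pi // liftU scale1r. Qed.

Lemma tensor_lift_additive (G : zmodType) (h : A -> B -> G) :
  balanced h -> zmod_morphism (tensor_lift h).
Proof.
move=> hh x y; rewrite -(reprK (x : Quotient.quot tensor_relations)).
rewrite -(reprK (y : Quotient.quot tensor_relations)).
rewrite -[_ - _](raddfB (\pi_(Quotient.quot tensor_relations))%qT).
by rewrite !tensor_lift_pi // lift_is_additive.
Qed.

Lemma tens_balanced : balanced tens.
Proof.
have eqt x y : x - y \in tensor_relations ->
    \pi_(Quotient.quot tensor_relations)%qT x =
    \pi_(Quotient.quot tensor_relations)%qT y.
  by rewrite Quotient.idealrBE => /eqP.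
split=> [a a' b|a b b'|a r b]; rewrite /tens -?raddfD; apply: eqt;
  by apply/asboolP => S _ [].
Qed.

Lemma tensor_ext (G : zmodType) (F F' : tensor -> G) :
  zmod_morphism F -> zmod_morphism F' ->
  (forall a b, F (tens a b) = F' (tens a b)) -> F =1 F'.
Proof.
move=> addF addF' eqF x.
pose Fm := GRing.isZmodMorphism.Build _ _ F addF.
pose F1 : {additive tensor -> G} := HB.pack F Fm.
pose Fm' := GRing.isZmodMorphism.Build _ _ F' addF'.
pose F1' : {additive tensor -> G} := HB.pack F' Fm'.
rewrite -[F]/(F1 : _ -> _) -[F']/(F1' : _ -> _).
rewrite -(reprK (x : Quotient.quot tensor_relations)).
rewrite -(freeg_sumE (repr _)).
rewrite (raddf_sum (\pi_(Quotient.quot tensor_relations))%qT).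
rewrite (raddf_sum F1) (raddf_sum F1'); apply: eq_bigr => -[a b] _.
rewrite -[coeff _ _]intz -freegU_mulz.
rewrite (raddfMz (\pi_(Quotient.quot tensor_relations))%qT).
by rewrite (raddfMz F1) (raddfMz F1') /= -[\pi_(_)%qT _]/(tens a b) eqF.
Qed.
End Tensor.

Section TensorMap.
Variables (R : nzRingType) (A : lmodType R^c).

Definition tensor_map (B C : lmodType R) (g : {linear B -> C}) :
    tensor A B -> tensor A C :=
  tensor_lift (fun a b => tens a (g b)).

Variables (B C : lmodType R) (g : {linear B -> C}).

Fact tensor_map_balanced : balanced (fun (a : A) b => tens a (g b)).
Proof.
have [tDl tDr tZ] := tens_balanced A C.
by split=> *; rewrite ?linearD ?linearZ /= ?tDl ?tDr ?tZ.
Qed.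

Lemma tensor_mapE a b : tensor_map g (tens a b) = tens a (g b).
Proof. exact/tensor_lift_tens/tensor_map_balanced. Qed.

Lemma tensor_map_additive : zmod_morphism (tensor_map g).
Proof. exact/tensor_lift_additive/tensor_map_balanced. Qed.
HB.instance Definition _ := GRing.isZmodMorphism.Build (tensor A B) (tensor A C)
  (tensor_map g) tensor_map_additive.
End TensorMap.

(******************************************************************************)
(*                                  Tor                                       *)
(******************************************************************************)

Definition exact_at (U V W : zmodType) (u : U -> V) (v : V -> W) : Prop :=
  forall y, v y = 0 <-> exists x, y = u x.

Definition projective (R : nzRingType) (P : lmodType R) : Prop :=
  forall (M N : lmodType R) (g : {linear M -> N}) (h : {linear P -> N}),
    (forall y, exists x, y = g x) ->
    exists k : {linear P -> M}, forall x, g (k x) = h x.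

Record projective_resolution (R : nzRingType) (B : lmodType R) := {
  res_obj :> nat -> lmodType R;
  res_diff : forall n, {linear res_obj n.+1 -> res_obj n};
  res_aug : {linear res_obj 0%N -> B};
  res_projective : forall n, projective (res_obj n);
  res_aug_surj : forall b, exists x, b = res_aug x;
  res_aug_exact : exact_at (res_diff 0) res_aug;
  res_exact : forall n, exact_at (res_diff n.+1) (res_diff n)
}.
Arguments res_projective {R B} p n.
Arguments res_aug_surj {R B} p b.
Arguments res_aug_exact {R B} p y.
Arguments res_exact {R B} p n y.

(* Tor_1^R(A, B) is H_1 of A tensored with a projective resolution P of B.    *)
(* Its vanishing does not depend on P (Tor1_eq0P), and such a P exists        *)
(* (free_resolution).                                                         *)
Definition Tor1_eq0 (R : nzRingType) (A : lmodType R^c) (B : lmodType R) :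
    Prop :=
  exists P : projective_resolution B,
    exact_at (@tensor_map R A _ _ (res_diff P 1))
             (@tensor_map R A _ _ (res_diff P 0)).

Section Kernel.
Variables (R : nzRingType) (U V : lmodType R) (g : {linear U -> V}).

Definition kernel : {pred U} := [pred x | g x == 0].
Fact kernel_closed : submod_closed kernel.
Proof.
split=> [|a x y]; rewrite !inE ?linear0 // linearP => /eqP-> /eqP->.
by rewrite scaler0 addr0.
Qed.
HB.instance Definition _ := GRing.isSubmodClosed.Build R U kernel kernel_closed.

Definition kernel_mod : Type := {x : U | x \in kernel}.
HB.instance Definition _ := [isSub of kernel_mod for @sval _ _].
HB.instance Definition _ := [Choice of kernel_mod by <:].
HB.instance Definition _ := [SubChoice_isSubLmodule of kernel_mod by <:].
End Kernel.

Lemma projective_lift (R : nzRingType) (P M N L : lmodType R)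
    (u : {linear M -> N}) (v : {linear N -> L}) (h : {linear P -> N}) :
  projective P -> exact_at u v -> (forall x, v (h x) = 0) ->
  exists k : {linear P -> M}, forall x, u (k x) = h x.
Proof.
move=> projP uv vh.
have vu x : v (u x) = 0 by apply/uv; exists x.
have uK x : u x \in kernel v by rewrite inE vu.
have hK x : h x \in kernel v by rewrite inE vh.
pose u1 x : kernel_mod v := Sub (u x) (uK x).
pose h1 x : kernel_mod v := Sub (h x) (hK x).
have linu : linear u1.
  by move=> a x y; apply: val_inj; rewrite /= linearP.
have linh : linear h1.
  by move=> a x y; apply: val_inj; rewrite /= linearP.
pose mu := GRing.isLinear.Build R M (kernel_mod v) *:%R u1 linu.
pose mh := GRing.isLinear.Build R P (kernel_mod v) *:%R h1 linh.
pose lu : {linear M -> kernel_mod v} := HB.pack u1 mu.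
pose lh : {linear P -> kernel_mod v} := HB.pack h1 mh.
have surj : forall y : kernel_mod v, exists x, y = lu x.
  move=> y; have /eqP/uv[x yx] := valP y.
  by exists x; apply: val_inj; rewrite yx.
have [k kP] := projP _ _ lu lh surj.
by exists k => x; have /(congr1 val) := kP x.
Qed.

Section TorIndependence.
Variables (R : nzRingType) (A : lmodType R^c) (B : lmodType R).
Local Notation T := (@tensor_map R A _ _).

Lemma Tor1_eq0P :
  Tor1_eq0 A B ->
  forall (P2 P1 P0 : lmodType R) (d2 : {linear P2 -> P1})
    (d1 : {linear P1 -> P0}) (e : {linear P0 -> B}),
    projective P1 -> projective P0 -> (forall b, exists x, b = e x) ->
    exact_at d1 e -> exact_at d2 d1 ->
    exact_at (@tensor_map R A _ _ d2) (@tensor_map R A _ _ d1).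
Proof.
move=> [Q Qex] P2 P1 P0 d2 d1 e pP1 pP0 esurj ex1 ex2 t.
pose q1 := res_diff Q 0; pose q2 := res_diff Q 1; pose a := res_aug Q.
have e1 x : e (d1 x) = 0 by apply/ex1; exists x.
have e2 x : d1 (d2 x) = 0 by apply/ex2; exists x.
have a1 x : a (q1 x) = 0 by apply/(res_aug_exact Q); exists x.
have a2 x : q1 (q2 x) = 0 by apply/(res_exact Q 0); exists x.
have [f0 f0E] := pP0 _ _ a e (res_aug_surj Q).
have [|f1 f1E] := projective_lift (h := f0 \o d1) pP1 (res_aug_exact Q).
  by move=> x /=; rewrite -/a f0E e1.
have [g0 g0E] := res_projective Q 0%N _ _ e a esurj.
have [|g1 g1E] := projective_lift (h := g0 \o q1) (res_projective Q 1) ex1.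
  by move=> x /=; rewrite g0E a1.
have [|g2 g2E] := projective_lift (h := g1 \o q2) (res_projective Q 2) ex2.
  by move=> x /=; rewrite g1E /= a2 linear0.
have [|s0 s0E] := projective_lift (h := (g0 \o f0) \- idfun) pP0 ex1.
  by move=> x /=; rewrite linearB /= g0E f0E subrr.
have [|s1 s1E] :=
    projective_lift (h := ((g1 \o f1) \- idfun) \- (s0 \o d1)) pP1 ex2.
  move=> x /=; rewrite !linearB /= g1E /= s0E /= -/q1.
  by have /= -> := f1E x; rewrite subrr.
split=> [dt|[y ->]]; last first.
  move: y; apply: (@tensor_ext _ _ _ _ (T d1 \o T d2) (fun=> 0)).
  - by move=> x y; rewrite /= !raddfB.
  - by move=> x y; rewrite subrr.
  move=> b c /=; rewrite !tensor_mapE e2.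
  by have [_ tD _] := tens_balanced A P0;
    apply: (addrI (tens b 0)); rewrite -tD !addr0.
have fc x : T q1 (T f1 x) = T f0 (T d1 x).
  move: x; apply: (@tensor_ext _ _ _ _ (T q1 \o T f1)
                    (T f0 \o T d1)) => [x y|x y|b c] /=;
    rewrite ?raddfB //.
  by rewrite !tensor_mapE f1E.
have gc x : T g1 (T q2 x) = T d2 (T g2 x).
  move: x; apply: (@tensor_ext _ _ _ _ (T g1 \o T q2)
                    (T d2 \o T g2)) => [x y|x y|b c] /=;
    rewrite ?raddfB //.
  by rewrite !tensor_mapE g2E.
have hc x : T d2 (T s1 x) =
    T g1 (T f1 x) - x - T s0 (T d1 x).
  move: x; apply: (@tensor_ext _ _ _ _ (T d2 \o T s1)
    (fun x => T g1 (T f1 x) - x - T s0 (T d1 x))).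
  - by move=> x y; rewrite /= !raddfB.
  - by move=> x y; rewrite !raddfB /= [RHS]addrACA [X in _ = X + _]addrACA.
  move=> b c /=; rewrite !tensor_mapE s1E /=.
  have [_ tD _] := tens_balanced A P1.
  have tN (z : P1) : tens b (- z) = - tens b z.
    apply: (addrI (tens b z)); rewrite -tD !subrr.
    by apply: (addrI (tens b 0)); rewrite -tD !addr0.
  by rewrite !tD !tN.
have /Qex [u fu] : T q1 (T f1 t) = 0 by rewrite fc dt raddf0.
exists (T g2 u - T s1 t).
by rewrite raddfB /= hc -gc -fu dt raddf0 subr0 subKr.
Qed.
End TorIndependence.

Section FreeResolution.
Variable R : nzRingType.

Fact fglift_linear (K : choiceType) (M : lmodType R) (h : K -> M) :
  linear (fglift h : {freeg K / R} -> M).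
Proof.
pose addF := @lift_is_additive R K M h.
pose mF := GRing.isZmodMorphism.Build _ _ _ addF.
pose F : {additive {freeg K / R} -> M} := HB.pack (fglift h) mF.
move=> a x y; rewrite -[fglift h]/(F : _ -> _) raddfD; congr (_ + _).
rewrite -{2}[x]freeg_sumE [a *: x]/(fgscale a x) /fgscale !raddf_sum /=.
by apply: eq_bigr => k _; rewrite !liftU scalerA.
Qed.
HB.instance Definition _ (K : choiceType) (M : lmodType R) (h : K -> M) :=
  GRing.isLinear.Build R {freeg K / R} M *:%R (fglift h) (fglift_linear h).

Lemma freeg_projective (K : choiceType) : projective {freeg K / R}.
Proof.
move=> M N g h gsurj.
have [k kE] := choice (fun u : K => gsurj (h << u >>)).
exists (fglift k) => x; rewrite -[x]freeg_sumE !raddf_sum /=.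
apply: eq_bigr => u _; rewrite liftU linearZ -kE.
have -> : << coeff u x *g u >> = coeff u x *: << u >> :> {freeg K / R}.
  by apply/eqP/freeg_eqP => z; rewrite coeffZ !coeffU mul1r.
by rewrite linearZ.
Qed.

Record lmap := LMap {
  lmap_dom : lmodType R;
  lmap_cod : lmodType R;
  lmap_fun : {linear lmap_dom -> lmap_cod}
}.

Definition free_cover (B : lmodType R) : {linear {freeg B / R} -> B} :=
  fglift (@id B).

Lemma free_coverE (B : lmodType R) (b : B) : free_cover B << b >> = b.
Proof. by rewrite /free_cover /= liftU scale1r. Qed.

Definition free_syzygy (m : lmap) : lmap :=
  @LMap {freeg (kernel_mod (lmap_fun m)) / R} (lmap_dom m)
    ((val : kernel_mod (lmap_fun m) -> lmap_dom m) \o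
       free_cover (kernel_mod (lmap_fun m))).

Lemma free_syzygy_exact (m : lmap) :
  exact_at (lmap_fun (free_syzygy m)) (lmap_fun m).
Proof.
move=> y; split=> [/eqP yK|[x ->]]; last by apply/eqP/(valP (free_cover _ x)).
by exists << (Sub y yK : kernel_mod (lmap_fun m)) >>; rewrite /= free_coverE.
Qed.

Fixpoint free_chain (B : lmodType R) (n : nat) : lmap :=
  if n is k.+1 then free_syzygy (free_chain B k) else LMap (free_cover B).

Fact free_chain_projective B n : projective (lmap_dom (free_chain B n)).
Proof. by case: n => [|n]; exact: freeg_projective. Qed.

Fact free_cover_surj (B : lmodType R) (b : B) : exists x, b = free_cover B x.
Proof. by exists << b >>; rewrite free_coverE. Qed.

Definition free_resolution (B : lmodType R) : projective_resolution B :=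
  @Build_projective_resolution R B (fun n => lmap_dom (free_chain B n))
    (fun n => lmap_fun (free_chain B n.+1)) (free_cover B)
    (@free_chain_projective B) (@free_cover_surj B)
    (@free_syzygy_exact (free_chain B 0))
    (fun n => @free_syzygy_exact (free_chain B n.+1)).
End FreeResolution.

(******************************************************************************)
(*                       Pseudo-Sylvester domains                             *)
(******************************************************************************)

Definition stably_finite (R : nzRingType) : Prop :=
  forall (n : nat) (A B : 'M[R]_n), A *m B = 1%:M -> B *m A = 1%:M.

Section InnerRank.
Variable R : nzRingType.

Definition factors_through (m n : nat) (A : 'M[R]_(m, n)) (k : nat) : Prop :=
  exists (B : 'M[R]_(m, k)) (C : 'M[R]_(k, n)), A = B *m C.

Fact inner_rank_subproof (m n : nat) (A : 'M[R]_(m, n)) :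
  exists k, `[< factors_through A k >].
Proof. by exists m; apply/asboolP; exists 1%:M, A; rewrite mul1mx. Qed.

Definition inner_rank (m n : nat) (A : 'M[R]_(m, n)) : nat :=
  ex_minn (inner_rank_subproof A).

Definition stabilize (m n : nat) (A : 'M[R]_(m, n)) (s : nat) :
    'M[R]_(m + s, n + s) :=
  block_mx A 0 0 1%:M.

(* A sequence of integers converges iff it is eventually constant. *)
Definition is_lim_int (u : nat -> int) (l : int) : Prop :=
  exists N : nat, forall s : nat, (N <= s)%N -> u s = l.

(* The limit, or 0 by convention if there is none, which does not happen over *)
(* stably finite rings (stable_rankP).                                        *)
Definition stable_rank (m n : nat) (A : 'M[R]_(m, n)) : int :=
  xget 0 [set l | is_lim_int
    (fun s => (inner_rank (stabilize A s))%:Z - s%:Z) l]%classic.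

Lemma inner_rankP (m n : nat) (A : 'M[R]_(m, n)) :
  factors_through A (inner_rank A) /\
  forall k, factors_through A k -> (inner_rank A <= k)%N.
Proof.
rewrite /inner_rank; case: ex_minnP => k /asboolP Ak kmin.
by split=> // j /asboolP; exact: kmin.
Qed.

Lemma is_lim_int_uniq u l l' : is_lim_int u l -> is_lim_int u l' -> l = l'.
Proof.
move=> [N hN] [N' hN']; rewrite -(hN (maxn N N')) ?leq_maxl //.
by rewrite -(hN' (maxn N N')) ?leq_maxr.
Qed.

Lemma stably_finite_factors1 (s k : nat) :
  stably_finite R -> factors_through (1%:M : 'M[R]_s) k -> (s <= k)%N.
Proof.
move=> sf [B [C BC]]; rewrite leqNgt; apply/negP => ks.
have sE : (k + (s - k) = s)%N by rewrite subnKC // ltnW.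
move: B C BC; rewrite -sE; set d := (s - k)%N => B C BC.
have d_gt0 : (0 < d)%N by rewrite subn_gt0.
have H : row_mx B 0 *m col_mx C (0 : 'M_(d, _)) = 1%:M.
  by rewrite mul_row_col mul0mx addr0 -BC.
have := sf _ _ _ H; rewrite mul_col_row !mulmx0 scalar_mx_block.
move=> /eq_block_mx [_ _ _] /matrixP /(_ (Ordinal d_gt0) (Ordinal d_gt0)).
by rewrite !mxE eqxx => /esym/eqP; rewrite oner_eq0.
Qed.

Lemma inner_rank_stabilize_ge (m n : nat) (A : 'M[R]_(m, n)) s :
  stably_finite R -> (s <= inner_rank (stabilize A s))%N.
Proof.
move=> sf; apply: stably_finite_factors1 => //.
have [[B [C BC]] _] := inner_rankP (stabilize A s).
exists (dsubmx B), (rsubmx C).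
have := BC; rewrite -{1}[B]vsubmxK -{1}[C]hsubmxK mul_col_row /stabilize.
by move=> /eq_block_mx [_ _ _].
Qed.

Lemma inner_rank_stabilizeS (m n : nat) (A : 'M[R]_(m, n)) s :
  (inner_rank (stabilize A (s + 1)) <= inner_rank (stabilize A s) + 1)%N.
Proof.
have [[B [C BC]] _] := inner_rankP (stabilize A s).
set r := inner_rank _ in B C BC *.
apply: (inner_rankP _).2.
have -> : stabilize A (s + 1) = castmx (esym (addnA m s 1), esym (addnA n s 1))
    (block_mx (stabilize A s) 0 0 1%:M).
  have := @block_mxAx R m s 1 n s 1 A 0 0 0 1%:M 0 0 0 1%:M.
  by rewrite /= !row_mx0 !col_mx0 -scalar_mx_block.
have cast_factors p q p' q' (E : (p = p') * (q = q')) (M : 'M[R]_(p, q)) k :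
    factors_through M k -> factors_through (castmx E M) k.
  by case: E => E1 E2; case: p' / E1; case: q' / E2; rewrite castmx_id.
apply: cast_factors; exists (block_mx B 0 0 1%:M), (block_mx C 0 0 1%:M).
by rewrite mulmx_block !mulmx0 !mul0mx !addr0 add0r mulmx1 -BC.
Qed.

Lemma stable_rankP (m n : nat) (A : 'M[R]_(m, n)) :
  stably_finite R ->
  0 <= stable_rank A /\
  is_lim_int (fun s => (inner_rank (stabilize A s))%:Z - s%:Z) (stable_rank A).
Proof.
move=> sf; pose v s := (inner_rank (stabilize A s) - s)%N.
have vE s : (inner_rank (stabilize A s))%:Z - s%:Z = (v s)%:Z.
  by rewrite subzn // inner_rank_stabilize_ge.
have vS s : (v s.+1 <= v s)%N.
  rewrite -addn1 /v; have := inner_rank_stabilizeS A s.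
  have := inner_rank_stabilize_ge A s sf; move: (inner_rank _) => a.
  by move: (inner_rank _) => b sa ba; rewrite leq_subLR addnAC subnKC.
have exv : exists k, `[< exists s, v s = k >].
  by exists (v 0%N); apply/asboolP; exists 0%N.
have [k /asboolP[N vN] kmin] := ex_minnP exv.
have lim : is_lim_int (fun s => (inner_rank (stabilize A s))%:Z - s%:Z) k%:Z.
  exists N => s Ns; rewrite vE; congr Posz; apply/eqP; rewrite eqn_leq.
  rewrite kmin ?andbT; last by apply/asboolP; exists s.
  rewrite -vN -(subnK Ns); elim: (s - N)%N => // i IH.
  exact: leq_trans (vS _) IH.
have -> : stable_rank A = k%:Z.
  by apply: xget_unique => // l /is_lim_int_uniq; exact.
by split.
Qed.
End InnerRank.

(* Non-triviality of R is part of nzRingType. *)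
Definition pseudo_sylvester_domain (R : nzRingType) : Prop :=
  stably_finite R /\
  (forall (m n k : nat) (A : 'M[R]_(m, n)) (B : 'M[R]_(n, k)),
     A *m B = 0 -> stable_rank A + stable_rank B <= n%:Z).

(* Main.v *)
(* Write A over D as L * pid_mx r * M with L, M invertible. It suffices that  *)
(* inner_rank (stabilize A s) <= r + s for some s: then stable ranks are at   *)
(* most ranks over D, for which Sylvester's law holds, and a square matrix    *)
(* invertible over some D' has the largest possible stable rank, hence full   *)
(* rank over D.                                                               *)
(*                                                                            *)
(* The rows of A lie in J = {x in R^n | x Z = 0}, where the columns of Z span *)
(* the kernel of A over D. By (2) and induction on the number of columns of   *)
(* Z, J + R^s is free, say with basis the rows of P, so stabilize A s factors *)
(* through P and it suffices that P has at most r + s rows, that is, that     *)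
(* y P = 0 over D forces y = 0. Modulo stabilisation, the right R-module      *)
(* {c | y c = 0} is free on the columns of a matrix Q; then P = Q W. If Q is  *)
(* also injective over D, Q W Z = P Z = 0 gives W Z = 0, so W = V P, Q V = 1  *)
(* and y = y Q V = 0.                                                         *)
(*                                                                            *)
(* The injectivity of Q over D is Tor_1(L, D) = 0, where L is the right       *)
(* R-module spanned by y. It follows from Tor_1(D, D) = 0 because the left    *)
(* syzygies in (2) give Tor_2(D / L, D) = 0.                                  *)

Require Import Defs.
From HB Require Import structures.
From mathcomp Require Import all_boot all_order all_algebra.
From mathcomp Require Import perm boolp.
From mathcomp.multinomials Require Import freeg.

Set Implicit Arguments.
Unset Strict Implicit.
Unset Printing Implicit Defensive.

Import Order.TTheory GRing.Theory Num.Theory.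
Local Open Scope ring_scope.

(** * Normal form of matrices over a division ring *)

(** The theorem follows from comparing ranks: if [A] over [R] has rank r over [D], then some
    [stabilize A s] factors over [R] through size at most r + s ([inner_rank_stabilize_leq]).
    Sylvester's law over [D] ([mx_normal_form_mul0]) then bounds the stable ranks. For universality,
    the factorisation maps to any [D'], where an invertible matrix forces n + s <= r + s.

    The comparison needs two facts about the left kernel over [R] of a matrix over [D]: after
    stabilisation it has a finite basis ([left_kernel_basis_exists]), and the basis stays
    independent over [D] ([left_kernel_basis_inj]). The second reduces to [right_kernel_basis_inj],
    where Tor enters. Let L be spanned on the right by y and M on the left by w. By
    [Tor1_eq0_criterion] the class of w in Tor_1(L, M) dies in Tor_1(L', M) for a finitely generated
    L' between L and [D]. By the left syzygies M has a free resolution of length one after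
    stabilisation, so Tor_1(L, M) -> Tor_1(L', M) is injective and w = 0. *)

Section InvertibleMatrices.
Variable R : nzRingType.

Lemma invertible_mx1 n : invertible_mx (1%:M : 'M[R]_n).
Proof. by exists 1%:M; rewrite !mul1mx. Qed.

Lemma invertible_mxM n (A B : 'M[R]_n) :
  invertible_mx A -> invertible_mx B -> invertible_mx (A *m B).
Proof.
move=> [A' [AA' A'A]] [B' [BB' B'B]]; exists (B' *m A').
by rewrite !mulmxA -(mulmxA A) BB' mulmx1 AA' -(mulmxA B') A'A mulmx1 B'B.
Qed.

Lemma invertible_tperm_mx n (i j : 'I_n) :
  invertible_mx (tperm_mx i j : 'M[R]_n).
Proof.
exists (tperm_mx i j).
by rewrite -perm_mxM tperm2 perm_mx1.
Qed.

Lemma invertible_block_diag m n (A : 'M[R]_m) (B : 'M[R]_n) :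
  invertible_mx A -> invertible_mx B -> invertible_mx (block_mx A 0 0 B).
Proof.
move=> [A' [AA' A'A]] [B' [BB' B'B]]; exists (block_mx A' 0 0 B').
by rewrite !mulmx_block !(mulmx0, mul0mx, addr0, add0r) AA' A'A BB' B'B
  -scalar_mx_block.
Qed.

Lemma invertible_lower_block m n (C : 'M[R]_(n, m)) :
  invertible_mx (block_mx 1%:M 0 C 1%:M).
Proof.
by exists (block_mx 1%:M 0 (- C) 1%:M); rewrite !mulmx_block !(mulmx0, mul0mx,
  mulmx1, mul1mx, addr0, add0r) addrN addNr -scalar_mx_block.
Qed.

Lemma invertible_upper_block m n (C : 'M[R]_(m, n)) :
  invertible_mx (block_mx 1%:M C 0 1%:M).
Proof.
by exists (block_mx 1%:M (- C) 0 1%:M); rewrite !mulmx_block !(mulmx0, mul0mx,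
  mulmx1, mul1mx, addr0, add0r) addrN addNr -scalar_mx_block.
Qed.
End InvertibleMatrices.

Section DivisionRing.
Variable D : unitRingType.
Hypothesis divD : is_division_ring D.

Definition mx_normal_form m n (A : 'M[D]_(m, n)) r : Prop :=
  exists (L : 'M[D]_m) (M : 'M[D]_n),
    [/\ (r <= m)%N, (r <= n)%N, invertible_mx L, invertible_mx M &
        A = L *m pid_mx r *m M].

Lemma mx_normal_formM m n (A : 'M[D]_(m, n)) r (L : 'M_m) (M : 'M_n) :
  invertible_mx L -> invertible_mx M ->
  mx_normal_form A r -> mx_normal_form (L *m A *m M) r.
Proof.
move=> iL iM [L' [M' [rm rn iL' iM' ->]]].
exists (L *m L'), (M' *m M); split=> //; try exact: invertible_mxM.
by rewrite !mulmxA.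
Qed.

(** One step of Gaussian elimination: clearing the row and column of the pivot [a] leaves its Schur
    complement. *)
Lemma mx_normal_form_block m n (a : D) (b : 'M[D]_(1, n)) (c : 'M[D]_(m, 1))
    (d : 'M[D]_(m, n)) r :
  a \is a GRing.unit -> mx_normal_form (d - c *m (a^-1)%:M *m b) r ->
  mx_normal_form (block_mx a%:M b c d) r.+1.
Proof.
move=> aU [L [M [rm rn iL iM dE]]].
have -> : block_mx a%:M b c d =
    block_mx 1%:M 0 (c *m (a^-1)%:M) 1%:M *m
      block_mx a%:M 0 0 (d - c *m (a^-1)%:M *m b) *m
      block_mx 1%:M ((a^-1)%:M *m b) 0 1%:M.
  rewrite !mulmx_block !(mulmx0, mul0mx, mulmx1, mul1mx, addr0, add0r).
  rewrite -!mulmxA -!scalar_mxM mulVr // mulmx1 [a%:M *m _]mulmxA.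
  rewrite -!scalar_mxM divrr // !mul1mx; congr block_mx.

  by rewrite addrCA subrr addr0.
apply: mx_normal_formM; [exact: invertible_lower_block|
  exact: invertible_upper_block|].
have -> : block_mx (a%:M : 'M_1) 0 0 (d - c *m (a^-1)%:M *m b) =
    block_mx a%:M 0 0 L *m pid_mx r.+1 *m block_mx 1%:M 0 0 M.
  have -> : pid_mx r.+1 =
      block_mx 1%:M 0 0 (pid_mx r) :> 'M[D]_(1 + m, 1 + n).
    apply/matrixP=> k l; rewrite !mxE; case: split_ordP => k' -> /[!mxE];
      by case: split_ordP => l' -> /[!mxE]; rewrite ?ord1 ?eqE.
  rewrite !mulmx_block !(mulmx0, mul0mx, mulmx1, mul1mx, addr0, add0r).
  by rewrite -dE.
exists (block_mx a%:M 0 0 L), (block_mx 1%:M 0 0 M); split=> //.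
  apply: invertible_block_diag => //; exists (a^-1)%:M.
  by rewrite -!scalar_mxM divrr ?mulVr.
by apply: invertible_block_diag => //; exact: invertible_mx1.
Qed.

Lemma mx_normal_form_exists m n (A : 'M[D]_(m, n)) :
  exists r, mx_normal_form A r.
Proof.
have nf0 m' n' : mx_normal_form (0 : 'M[D]_(m', n')) 0.
  exists 1%:M, 1%:M; split=> //; try exact: invertible_mx1.
  by rewrite pid_mx_0 mulmx0 mul0mx.
elim: m n A => [|m IH] n A; first by exists 0%N; rewrite [A]flatmx0.
have [->|/matrix0Pn[i [j Aij]]] := eqVneq A 0; first by exists 0%N.
case: n A j Aij => [|n] A j Aij; first by case: j Aij.
pose B : 'M[D]_(m.+1, n.+1) := xrow i 0 (xcol j 0 A).
have AE : A = tperm_mx i 0 *m B *m tperm_mx j 0.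
  by rewrite /B -xrowE -xcolE; apply/matrixP=> k l; rewrite !mxE !tpermK.
have : B 0 0 != 0 by rewrite !mxE !tpermR.
move: B AE => B -> B00.
have [r nf] := IH n (drsubmx (B : 'M_(1 + m, 1 + n)) -
  dlsubmx (B : 'M_(1 + m, 1 + n)) *m ((B 0 0)^-1)%:M *m
  ursubmx (B : 'M_(1 + m, 1 + n))).
exists r.+1; apply: mx_normal_formM; try exact: invertible_tperm_mx.
move: nf => /(mx_normal_form_block (divD B00)).
have -> : (B 0 0)%:M = ulsubmx (B : 'M_(1 + m, 1 + n)).
  by rewrite [RHS]mx11_scalar !mxE; congr (B _ _)%:M; apply: val_inj.
by rewrite submxK.
Qed.

Lemma division_ring_stably_finite : stably_finite D.
Proof.
move=> n A B AB0.
have [r [L [M [rn _ [L' [LL' L'L]] [M' [MM' M'M]] AE]]]] :=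
  mx_normal_form_exists A.
have AB : L' *m A *m (B *m L) = 1%:M by rewrite mulmxA -(mulmxA L') AB0 mulmx1.
(* If r < n, row r of [L' *m A = pid_mx r *m M] vanishes, although [L' *m A] has a right inverse. *)
have rE : r = n.
  apply/eqP; rewrite eqn_leq rn leqNgt; apply/negP => ltrn.
  move/matrixP/(_ (Ordinal ltrn) (Ordinal ltrn)): AB.
  rewrite AE !mulmxA L'L mul1mx -!mulmxA mxE big1 => [|k _].
    by rewrite mxE eqxx => /esym/eqP; rewrite oner_eq0.
  by rewrite !mxE /= ltnn andbF mul0r.
rewrite rE pid_mx_1 mulmx1 in AE.
have [A' [_ A'A]] : invertible_mx A.
  by rewrite AE; apply: invertible_mxM; [exists L' | exists M'].
suff -> : B = A' by [].
by rewrite -[A']mulmx1 -AB0 mulmxA A'A mul1mx.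
Qed.

End DivisionRing.

Section DivisionRingRank.
Variable D : unitRingType.
Hypothesis divD : is_division_ring D.

Lemma left_injective_mx_leq t n (A : 'M[D]_(t, n)) :
  (forall y : 'rV_t, y *m A = 0 -> y = 0) -> (t <= n)%N.
Proof.
move=> Ainj; have [r [L [M [_ rn [L' [LL' L'L]] _ AE]]]] :=
  mx_normal_form_exists divD A.
rewrite leqNgt; apply/negP => nt; have rt := leq_ltn_trans rn nt.
have /Ainj y0 : (delta_mx 0 (Ordinal rt) : 'rV_t) *m L' *m A = 0.
  rewrite AE !mulmxA -(mulmxA _ L') L'L mulmx1 -rowE.
  have -> : row (Ordinal rt) (pid_mx r) = 0 :> 'rV[D]_n.
    by apply/rowP => j; rewrite !mxE /= ltnn andbF.
  by rewrite mul0mx.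
have /matrixP/(_ 0 (Ordinal rt)) :
    delta_mx 0 (Ordinal rt) = 0 :> 'rV[D]_t.
  by rewrite -[LHS]mulmx1 -L'L mulmxA y0 mul0mx.
by rewrite !mxE !eqxx => /eqP; rewrite oner_eq0.
Qed.

(** Sylvester's law: in suitable coordinates the row space of [A] is spanned by r independent rows
    [T] whose first r' entries vanish. Stacked on the first r' unit vectors, they remain independent
    in [D]^n. *)
Lemma mx_normal_form_mul0 m n k (A : 'M[D]_(m, n)) (B : 'M[D]_(n, k)) r r' :
  mx_normal_form A r -> mx_normal_form B r' -> A *m B = 0 -> (r + r' <= n)%N.
Proof.
move=> [L [M [rm rn [L' [LL' L'L]] [M' [MM' M'M]] ->]]].
move=> [K [N [r'n r'k [K' [KK' K'K]] [N' [NN' N'N]] ->]]] AB.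
pose T : 'M[D]_(r, n) := pid_mx r *m (M *m K).
have T_inj (u : 'rV_r) : u *m T = 0 -> u = 0.
  have TV : T *m (K' *m M' *m (pid_mx r : 'M_(n, r))) = 1%:M.
    rewrite /T -!mulmxA (mulmxA K) KK' mul1mx (mulmxA M) MM' mul1mx.
    by rewrite pid_mx_id // pid_mx_1.
  by move=> uT; rewrite -[u]mulmx1 -TV mulmxA uT mul0mx.
have Tp : T *m (pid_mx r' : 'M_(n, r')) = 0.
  have : L' *m (L *m pid_mx r *m M *m (K *m pid_mx r' *m N)) *m N' = 0.
    by rewrite AB mulmx0 mul0mx.
  rewrite !mulmxA L'L mul1mx -(mulmxA _ N) NN' mulmx1 => /(congr1
    (fun X => (pid_mx r : 'M_(r, m)) *m X *m (pid_mx r' : 'M_(k, r')))).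
  rewrite mulmx0 mul0mx !mulmxA pid_mx_id // -[in LHS]mulmxA pid_mx_id //.
  by rewrite /T !mulmxA.
apply: (@left_injective_mx_leq _ _ (col_mx T (pid_mx r'))) => y.
rewrite -{1}[y]hsubmxK mul_row_col => y0.
have yr : rsubmx y = 0.
  have := congr1 (mulmx^~ (pid_mx r' : 'M_(n, r'))) y0.
  rewrite mulmxDl -(mulmxA _ T) Tp mulmx0 add0r -mulmxA pid_mx_id //.
  by rewrite pid_mx_1 mulmx1 mul0mx.
have yl : lsubmx y = 0 by apply: T_inj; rewrite -y0 yr mul0mx addr0.
by rewrite -[y]hsubmxK yl yr row_mx0.
Qed.

End DivisionRingRank.

(** * Bases of syzygy modules *)

Section FiniteBases.
Variables (S : nzRingType) (U : lmodType S).

Definition in_span t (u : 'I_t -> U) (x : U) : Prop :=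
  exists c : 'I_t -> S, x = \sum_i c i *: u i.

Definition finite_basis t (u : 'I_t -> U) : Prop :=
  (forall x, in_span u x) /\
  (forall c : 'I_t -> S, \sum_i c i *: u i = 0 -> forall i, c i = 0).

Lemma in_spanZ t (u : 'I_t -> U) a x : in_span u x -> in_span u (a *: x).
Proof.
move=> [c ->]; exists (fun i => a * c i); rewrite scaler_sumr.
by apply: eq_bigr => i _; rewrite scalerA.
Qed.

Lemma in_span_sum t (u : 'I_t -> U) (V : eqType) (F : V -> U) (s : seq V) :
  {in s, forall v, in_span u (F v)} -> in_span u (\sum_(v <- s) F v).
Proof.
elim: s => [_|v s IH Fs].
  by exists (fun=> 0); rewrite big_nil big1 // => i _; rewrite scale0r.
have [|d dE] := IH; first by move=> w ws; apply: Fs; rewrite inE ws orbT.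
have [|c cE] := Fs v; first by rewrite inE eqxx.
exists (fun i => c i + d i); rewrite big_cons cE dE -big_split /=.
by apply: eq_bigr => i _; rewrite scalerDl.
Qed.

(** Only the finitely many basis vectors that occur in the expansions of the generators are
    needed. *)
Lemma module_basis_finite (B : {pred U}) :
  module_fg U -> module_basis B -> exists t (u : 'I_t -> U), finite_basis u.
Proof.
move=> [m [e [_ eP]]] [Bspan Bfree].
have /choice[s /choice[c sP]] i := Bspan (e i).
pose l := undup (flatten (codom s)).
have lB : {subset l <= B}.
  move=> x; rewrite mem_undup => /flattenP[_ /codomP[i ->]].
  exact: (sP i).1.
pose u (j : 'I_(size l)) := nth 0 l j.
have ul x : x \in l -> in_span u x.
  move=> xl; have il : (index x l < size l)%N by rewrite index_mem.
  exists (fun j => (j == Ordinal il)%:R).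
  rewrite (bigD1 (Ordinal il)) //= eqxx scale1r big1 => [|j /negPf->].
    by rewrite addr0 /u nth_index.
  by rewrite scale0r.
have u_inj i j : (u i == u j) = (i == j).
  by rewrite /u nth_uniq ?undup_uniq.
exists (size l), u; split=> [x|d dE i].
  have [a ->] := eP x (erefl : x \in predT).
  apply: in_span_sum => i _; apply: in_spanZ; have [_ ->] := sP i.
  apply: in_span_sum => b bs; apply/in_spanZ/ul; rewrite mem_undup.
  by apply/flattenP; exists (s i); rewrite ?codom_f.
(* Freeness of [B] takes coefficients indexed by vectors, so [d] is transported along the injective
   [u]. *)
pose k b := \sum_(j | u j == b) d j.
have kE j : k (u j) = d j.
  by rewrite /k (eq_bigl (pred1 j)) ?big_pred1_eq // => j'; rewrite u_inj.
rewrite -kE; apply: (Bfree l k (undup_uniq _) lB); last exact: mem_nth.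
rewrite (big_nth 0) big_mkord -[RHS]dE; apply: eq_bigr => j _.
by rewrite -[l`_j]/(u j) kE.
Qed.

End FiniteBases.

Section StablyFreeSyzygies.
Variables (S : nzRingType) (U : lmodType S).

Lemma module_fg_prod_rV (J : lmodType S) s :
  module_fg J -> module_fg (J * 'rV[S]_s)%type.
Proof.
move=> [m [e [_ eP]]].
exists (m + s)%N, (fun i => match split i with
  | inl j => (e j, 0) | inr j => (0, delta_mx 0 j) end); split=> // -[x v] _.
have [a xE] := eP x (erefl : x \in predT).
exists (fun i => match split i with inl j => a j | inr j => v 0 j end).
rewrite big_split_ord /=.
under eq_bigr => i _ do rewrite (unsplitK (inl _ i)) /=.
under [X in _ = _ + X]eq_bigr => i _ do rewrite (unsplitK (inr _ i)) /=.
have sumE (I : finType) (F : I -> J * 'rV[S]_s) :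
    \sum_i F i = (\sum_i (F i).1, \sum_i (F i).2).
  by elim/big_rec3: _ => // i x1 x2 x3 _ ->.
rewrite !sumE /= -xE; congr (_, _) => /=.
  by rewrite [X in _ = _ + X]big1 ?addr0 // => i _; rewrite scaler0.
rewrite big1 ?add0r => [|i _]; last by rewrite scaler0.
by rewrite {1}[v]row_sum_delta.
Qed.

(** The relations J among the [z j] are stably free. The sum of J and S^s sits in S^(n + s), with
    the last s coordinates unconstrained; the rows of [P] are a basis of it. *)
Lemma syzygy_basis (syz : stably_free_syzygies S U) n (z : 'I_n -> U) :
  exists s t (P : 'M[S]_(t, n + s)),
    [/\ forall i, \sum_j P i (lshift s j) *: z j = 0,
        forall x : 'rV_(n + s), \sum_j x 0 (lshift s j) *: z j = 0 ->
          exists c, x = c *m P &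
        forall c : 'rV_t, c *m P = 0 -> c = 0].
Proof.
pose p0 (v : 'rV[S]_n) := \sum_j v 0 j *: z j.
have linp0 : linear p0.
  move=> a u v; rewrite /p0 scaler_sumr -big_split; apply: eq_bigr => j _ /=.
  by rewrite !mxE scalerDl scalerA.
pose mp := GRing.isLinear.Build S 'rV[S]_n U *:%R p0 linp0.
pose p : {linear 'rV[S]_n -> U} := HB.pack p0 mp.
pose M : {pred U} := [pred x | `[< exists v, x = p v >]].
have MP x : reflect (exists v, x = p v) (x \in M) by exact: asboolP.
have cM : submod_closed M.
  split=> [|a _ _ /MP[u ->] /MP[v ->]].
    by apply/MP; exists 0; rewrite linear0.
  by apply/MP; exists (a *: u + v); rewrite linearP.
have fgM : submodule_fg M.
  exists n, z; split=> [i|_ /MP[v ->]]; last by exists (v 0).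
  apply/MP; exists (delta_mx 0 i); rewrite /p /= /p0 (bigD1 i) //= big1.
    by rewrite mxE !eqxx scale1r addr0.
  by move=> j /negPf ji; rewrite mxE ji andbF scale0r.
have [||x|fgJ [s [B Bbasis]]] :=
    syz M cM fgM n (kernel_mod p) (val : kernel_mod p -> 'rV[S]_n) p.
- exact: val_inj.
- move=> v; split=> [/eqP vK|[j ->]]; last by apply/eqP/(valP j).
  by exists (Sub v vK).
- by split=> [/MP|/MP].
have [t [u [uspan ufree]]] :=
  module_basis_finite (module_fg_prod_rV s fgJ) Bbasis.
pose io (w : kernel_mod p * 'rV[S]_s) : 'rV_(n + s) := row_mx (val w.1) w.2.
have io_sum (c : 'I_t -> S) :
    io (\sum_i c i *: u i) = \sum_i c i *: io (u i).
  rewrite /io !linear_sum /=.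
  under [RHS]eq_bigr do rewrite scale_row_mx.
  by elim/big_rec3: _ => [|i x y w _ <-]; rewrite ?row_mx0 ?add_row_mx.
exists s, t, (\matrix_i io (u i)); split=> [i|x xz|c].
- under eq_bigr => j _ do rewrite mxE row_mxEl.
  exact/eqP/(valP (u i).1).
- have /eqP xK : p (lsubmx x) = 0.
    by rewrite -[RHS]xz; apply: eq_bigr => j _; rewrite mxE.
  have [c xE] := uspan (Sub (lsubmx x) xK, rsubmx x).
  exists (\row_i c i); rewrite mulmx_sum_row.
  under eq_bigr => i _ do rewrite mxE rowK.
  by rewrite -io_sum -xE /io /= hsubmxK.
rewrite mulmx_sum_row; under eq_bigr => i _ do rewrite rowK.
rewrite -io_sum => io0; apply/rowP => i; rewrite mxE; move: i; apply: ufree.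
move: io0; rewrite /io -[RHS]row_mx0 => /eq_row_mx[].
case: (\sum_i _) => x y /= x0 ->; congr (_, _).
exact: val_inj.
Qed.
End StablyFreeSyzygies.

Section KernelBases.
Variables (R : nzRingType) (D : unitRingType) (f : {rmorphism R -> D}).

Definition left_kernel_basis n k t (Z : 'M[D]_(n, k)) (P : 'M[R]_(t, n)) :=
  [/\ map_mx f P *m Z = 0,
      forall m (X : 'M[R]_(m, n)), map_mx f X *m Z = 0 -> exists C, X = C *m P &
      forall m (C : 'M[R]_(m, t)), C *m P = 0 -> C = 0].

Definition right_kernel_basis n k t (Y : 'M[D]_(k, n)) (Q : 'M[R]_(n, t)) :=
  [/\ Y *m map_mx f Q = 0,
      forall m (X : 'M[R]_(n, m)), Y *m map_mx f X = 0 -> exists C, X = Q *m C &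
      forall m (C : 'M[R]_(t, m)), Q *m C = 0 -> C = 0].

Lemma left_kernel_basis_cV (syz : stably_free_syzygies R (left_restriction f))
    n (z : 'cV[D]_n) :
  exists s t (P : 'M[R]_(t, n + s)),
    left_kernel_basis (col_mx z (0 : 'cV_s)) P.
Proof.
have [s [t [P [Pz Pspan Pfree]]]] :=
  syzygy_basis syz (fun j => z j 0 : left_restriction f).
have zE m (X : 'M[R]_(m, n + s)) i j :
    (map_mx f X *m col_mx z (0 : 'cV_s)) i j =
    \sum_k (X i (lshift s k) : R) *: (z k 0 : left_restriction f).
  rewrite ord1 mxE big_split_ord /= [X in _ + X]big1 ?addr0 => [|k _].
    by apply: eq_bigr => k _; rewrite mxE col_mxEu.
  by rewrite col_mxEd !mxE mulr0.
exists s, t, P; split=> [|m X XZ|m C CP].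
- by apply/matrixP => i j; rewrite zE Pz mxE.
- have /choice[c cE] i : exists c : 'rV_t, row i X = c *m P.
    apply: Pspan; have /matrixP/(_ i 0) := XZ; rewrite zE mxE; apply: etrans.
    by apply: eq_bigr => k _; rewrite mxE.
  exists (\matrix_i c i); apply/row_matrixP => i.
  by rewrite row_mul rowK cE.
apply/row_matrixP => i; rewrite row0; apply: Pfree.
by rewrite -row_mul CP row0.
Qed.

Lemma right_kernel_basis_rV
    (syz : stably_free_syzygies (R^c)%type (right_restriction f))
    n (y : 'rV[D]_n) :
  exists s t (Q : 'M[R]_(n + s, t)),
    right_kernel_basis (row_mx y (0 : 'rV_s)) Q.
Proof.
have [s [t [P [Py Pspan Pfree]]]] :=
  syzygy_basis syz (fun j => y 0 j : right_restriction f).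
have yE m (X : 'M[R]_(n + s, m)) i j :
    (row_mx y (0 : 'rV_s) *m map_mx f X) i j =
    \sum_k (X (lshift s k) j : R^c) *: (y 0 k : right_restriction f).
  rewrite ord1 mxE big_split_ord /= [X in _ + X]big1 ?addr0 => [|k _].
    by apply: eq_bigr => k _; rewrite row_mxEl mxE.
  by rewrite row_mxEr !mxE mul0r.
(* Transposition reverses products between [R^c] and [R], so row relations over [R^c] become column
   relations over [R]. *)
pose Q : 'M[R]_(n + s, t) := (P : 'M[R]_(t, n + s))^T.
have QE m (C : 'M[R]_(t, m)) j :
    ((row j C^T : 'rV[R^c]_t) *m P)^T = col j (Q *m C) :> 'cV[R]_(n + s).
  rewrite trmx_mul_rev; apply/matrixP => k l; rewrite !mxE.
  by apply: eq_bigr => i _; rewrite !mxE.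
exists s, t, Q; split=> [|m X YX|m C QC].
- apply/matrixP => i j; rewrite yE mxE -[RHS](Py j).
  by apply: eq_bigr => k _; rewrite mxE.
- have /choice[c cE] j :
      exists c : 'rV[R^c]_t, (row j X^T : 'rV[R^c]_(n + s)) = c *m P.
    apply: Pspan; have /matrixP/(_ 0 j) := YX; rewrite yE mxE; apply: etrans.
    by apply: eq_bigr => k _; rewrite !mxE.
  pose C : 'M[R]_(t, m) := \matrix_(i, j) c j 0 i.
  exists C; apply: trmx_inj; apply/row_matrixP => j; rewrite -!tr_col -QE.
  have -> : row j C^T = c j :> 'rV[R^c]_t by apply/rowP => i; rewrite !mxE.
  by rewrite -cE; apply/matrixP => i k; rewrite !mxE.
apply: trmx_inj; apply/row_matrixP => j; rewrite -!tr_col col0.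
have -> : col j C = (row j C^T)^T by rewrite tr_row trmxK.
have -> : row j C^T = 0 :> 'rV[R^c]_t.
  apply: Pfree; have := QE _ C j; rewrite QC col0 => /(congr1 trmx).
  by rewrite trmxK trmx0.
by rewrite trmx0.
Qed.

End KernelBases.

(** * Vanishing of Tor *)

Lemma freeg_sum_coeff (R : nzRingType) (K : choiceType) (l : seq K)
    (x : {freeg K / R}) :
  uniq l -> {subset dom x <= l} -> x = \sum_(z <- l) coeff z x *: << z >>.
Proof.
move=> lU xl; apply/eqP/freeg_eqP => u; rewrite raddf_sum /=.
under eq_bigr => z _ do rewrite coeffZ coeffU mul1r.
have [ul|ul] := boolP (u \in l).
  rewrite (bigD1_seq u) //= eqxx mulr1 big1 ?addr0 // => z /negPf->.
  by rewrite mulr0.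
rewrite coeff_outdom; last by apply: contra ul; exact: xl.
rewrite big_seq big1 // => z zl; case: eqP => [zu|_]; last by rewrite mulr0.
by rewrite zu (negPf ul) in zl.
Qed.

Lemma fglift_sum_coeff (R : nzRingType) (K : choiceType) (M : lmodType R)
    (h : K -> M) (l : seq K) (x : {freeg K / R}) :
  uniq l -> {subset dom x <= l} -> fglift h x = \sum_(z <- l) coeff z x *: h z.
Proof.
move=> lU xl; rewrite {1}(freeg_sum_coeff lU xl) linear_sum /=.
by apply: eq_bigr => z _; rewrite linearZ /= liftU scale1r.
Qed.

Lemma sum_nth (T : zmodType) (V : nmodType) (l : seq T) (G : T -> V) :
  \sum_(i < size l) G l`_i = \sum_(z <- l) G z.
Proof. by rewrite (big_nth 0) big_mkord. Qed.

Lemma sum_eq_nth (T : zmodType) (S : nzRingType) (l : seq T) (x : T)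
    (G : T -> S) :
  uniq l -> x \in l -> \sum_(i < size l) (x == l`_i)%:R * G l`_i = G x.
Proof.
move=> lU xl; rewrite (sum_nth _ (fun z => (x == z)%:R * G z)).
rewrite (bigD1_seq x) //= eqxx mul1r big1 ?addr0 // => z.
by rewrite eq_sym => /negPf->; rewrite mul0r.
Qed.

Section TensorSums.
Variables (R : nzRingType) (A : lmodType R^c) (B : lmodType R).

Lemma tens0l (b : B) : tens (0 : A) b = 0.
Proof.
have [tD _ _] := tens_balanced A B.
by apply: (addrI (tens (0 : A) b)); rewrite -tD !addr0.
Qed.

Lemma tens0r (a : A) : tens a (0 : B) = 0.
Proof.
have [_ tD _] := tens_balanced A B.
by apply: (addrI (tens a (0 : B))); rewrite -tD !addr0.
Qed.

Lemma tens_suml (I : Type) (s : seq I) (a : I -> A) (b : B) :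
  tens (\sum_(i <- s) a i) b = \sum_(i <- s) tens (a i) b.
Proof.
have [tD _ _] := tens_balanced A B.
elim: s => [|i s IH]; first by rewrite !big_nil tens0l.
by rewrite !big_cons tD IH.
Qed.

Lemma tens_sumr (I : Type) (s : seq I) (a : A) (b : I -> B) :
  tens a (\sum_(i <- s) b i) = \sum_(i <- s) tens a (b i).
Proof.
have [_ tD _] := tens_balanced A B.
elim: s => [|i s IH]; first by rewrite !big_nil tens0r.
by rewrite !big_cons tD IH.
Qed.

Lemma tensNl (a : A) (b : B) : tens (- a) b = - tens a b.
Proof.
have [tD _ _] := tens_balanced A B.
apply: (addrI (tens a b)); rewrite -tD !subrr.
exact: tens0l.
Qed.

Lemma tensor_sumP (x : tensor A B) :
  exists n (a : 'I_n -> A) (b : 'I_n -> B), x = \sum_i tens (a i) (b i).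
Proof.
pose T (y : tensor A B) :=
  exists s : seq (A * B), y = \sum_(ab <- s) tens ab.1 ab.2.
have TD y z : T y -> T z -> T (y + z).
  by move=> [s ->] [s' ->]; exists (s ++ s'); rewrite big_cat.
have TN y : T y -> T (- y).
  move=> [s ->]; exists [seq (- ab.1, ab.2) | ab <- s].
  by rewrite big_map -sumrN; apply: eq_bigr => ab _; rewrite tensNl.
have T0 : T 0 by exists [::]; rewrite big_nil.
have TM y (m : int) : T y -> T (y *~ m).
  move=> Ty; have Tn n : T (y *+ n).
    by elim: n => [|n IH]; rewrite ?mulr0n // mulrS; exact: TD.
  by case: m => m; [exact: Tn | rewrite NegzE mulrNz; exact/TN/Tn].
have [s ->] : T x.
  rewrite -(reprK (x : Quotient.quot (@tensor_relations _ A B))).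
  rewrite -(freeg_sumE (repr _)).
  rewrite (raddf_sum (\pi_(Quotient.quot (@tensor_relations _ A B)))%qT).
  elim/big_rec: _ => [//|[a b] z _ Tz]; apply: TD => //.
  rewrite -[coeff _ _]intz -freegU_mulz.
  rewrite (raddfMz (\pi_(Quotient.quot (@tensor_relations _ A B)))%qT).
  by apply: TM; exists [:: (a, b)]; rewrite big_seq1.
exists (size s), (fun i => (nth 0 s i).1), (fun i => (nth 0 s i).2).
by rewrite (big_nth 0) big_mkord.
Qed.
End TensorSums.

Section TorCriterion.
Variables (R : nzRingType) (D : unitRingType) (f : {rmorphism R -> D}).
Local Notation A := (right_restriction f).
Local Notation B := (left_restriction f).

(** This induces the coordinate map at [k] from D (x) R^(K) to [D]. *)
Lemma coeff_balanced (K : choiceType) (k : K) :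
  balanced (fun (a : A) (x : {freeg K / R}) => (a : D) * f (coeff k x)).
Proof.
split=> [a a' x|a x x'|a r x]; first by rewrite mulrDl.
  by rewrite coeffD rmorphD mulrDr.
by rewrite coeffZ rmorphM mulrA.
Qed.

(* The element \sum_i y_i (x) Q_i of D (x) N, for N the kernel of the free   *)
(* cover F of D and Q_i = \sum_j Q_ij [w_j], is mapped to 0 in D (x) F, hence *)
(* is 0; (X, P, a) is what the equational criterion for the vanishing of such *)
(* a sum provides. The 0/1 matrix E merges equal entries of w.               *)
Lemma Tor1_eq0_criterion (tor : Tor1_eq0 A B) t v (y : 'rV[D]_t)
    (Q : 'M[R]_(t, v)) (w : 'cV[D]_v) :
  y *m map_mx f Q = 0 -> map_mx f Q *m w = 0 ->
  exists q (a : 'rV[D]_q) s (X : 'M[R]_(t + q, s)) p (P : 'M[R]_(s, p))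
      (E : 'M[R]_(v, p)) (z : 'cV[D]_p),
    [/\ w = map_mx f E *m z, col_mx (Q *m E) 0 = X *m P,
        row_mx y a *m map_mx f X = 0 & map_mx f P *m z = 0].
Proof.
move=> yQ Qw.
pose e := free_cover B.
pose N := kernel_mod e.
pose d1 : {linear {freeg N / R} -> {freeg B / R}} := lmap_fun (free_chain B 1).
pose F2 := {freeg (kernel_mod d1) / R} : lmodType R.
pose d2 : {linear F2 -> {freeg N / R}} := lmap_fun (free_chain B 2).
have ex1 : exact_at d1 e := @free_syzygy_exact _ (free_chain B 0).
have ex2 : exact_at d2 d1 := @free_syzygy_exact _ (free_chain B 1).
have ext : exact_at (@tensor_map _ A _ _ d2) (@tensor_map _ A _ _ d1).
  apply: (Tor1_eq0P tor _ _ _ ex1 ex2); try exact: freeg_projective.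
  exact: free_cover_surj.
pose q i : {freeg B / R} := \sum_j Q i j *: << (w j 0 : B) >>.
have qK i : q i \in kernel e.
  rewrite inE /q linear_sum /=; apply/eqP.
  have /matrixP/(_ i 0) := Qw; rewrite !mxE; apply: etrans.
  apply: eq_bigr => j _; rewrite linearZ /= mxE /e.
  by rewrite (free_coverE (w j 0 : B)).
pose n i : N := Sub (q i) (qK i).
pose tau : tensor A _ := \sum_i tens (y 0 i : A) (<< n i >> : {freeg _ / R}).
have : tensor_map d1 tau = 0.
  rewrite raddf_sum /=.
  under eq_bigr => i _ do rewrite (tensor_mapE d1).
  have tZ := let: And3 _ _ tZ := tens_balanced A {freeg B / R} in tZ.
  have qE i : tens (y 0 i : A) (d1 << n i >>) =
      \sum_j tens ((Q i j : R^c) *: (y 0 i : A))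
        (<< (w j 0 : B) >> : {freeg B / R}).
    rewrite /d1 /= free_coverE /= /q tens_sumr.
    by apply: eq_bigr => j _; rewrite tZ.
  rewrite (eq_bigr _ (fun i _ => qE i)) exchange_big big1 //= => j _.
  rewrite -tens_suml.
  have -> : \sum_i (Q i j : R^c) *: (y 0 i : A) = 0.
    have /matrixP/(_ 0 j) := yQ; rewrite !mxE; apply: etrans.
    by apply: eq_bigr => i _; rewrite mxE.
  by rewrite tens0l.
(* Vanishing of Tor_1(D, D) makes [tau] a boundary: it equals \sum_i a_i (x) h_i, where every h_i is
   a relation in [N]. *)
move=> /ext[sigma tauE].
have [k [a [g sigmaE]]] := tensor_sumP sigma.
pose h i := d2 (g i).
pose l : seq N := undup (codom n ++ flatten (codom (fun i => dom (h i)))).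
have nl i : n i \in l by rewrite mem_undup mem_cat codom_f.
have hl i : {subset dom (h i) <= l}.
  move=> x xh; rewrite mem_undup mem_cat; apply/orP; right.
  by apply/flattenP; exists (dom (h i)); rewrite ?codom_f.
pose m : seq B :=
  undup (codom (fun j => w j 0) ++ flatten [seq dom (val x) | x <- l]).
have wm j : w j 0 \in m.
  by rewrite mem_undup mem_cat (codom_f (fun j => w j 0 : B)).
have lm x : x \in l -> {subset dom (val x) <= m}.
  move=> xl u ux; rewrite mem_undup mem_cat; apply/orP; right.
  by apply/flattenP; exists (dom (val x)) => //; exact: map_f.
(* The rows of [X] are the coordinates of the [n_i] and of the -h_i; [P] expands the elements of [l]
   in the free module on [m]. The rows of [X *m P] are thus the q_i and -d1(h_i) = 0. *)
pose X : 'M[R]_(t + k, size l) := \matrix_(i, c)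
  match split i with
  | inl i' => (n i' == l`_c)%:R | inr i' => - coeff l`_c (h i') end.
pose P : 'M[R]_(size l, size m) := \matrix_(c, j) coeff m`_j (val l`_c).
exists k, (\row_i (a i : D)), (size l), X, (size m), P,
  (\matrix_(i, j) ((w i 0 : B) == m`_j)%:R), (\col_j m`_j).
split.
- apply/colP => j; rewrite !mxE.
  rewrite -[LHS](sum_eq_nth id (undup_uniq _) (wm j)).
  by apply: eq_bigr => i _; rewrite !mxE rmorph_nat.
- have XP i j : (X *m P) i j = match split i with
    | inl i' => coeff m`_j (q i') | inr i' => - coeff m`_j (d1 (h i')) end.
    rewrite mxE; under eq_bigr => c _ do rewrite !mxE.
    case: split => i'.
      exact: (sum_eq_nth (fun z => coeff m`_j (val z)) (undup_uniq _) (nl i')).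
    have -> : d1 (h i') = \sum_(z <- l) coeff z (h i') *: val z.
      rewrite -[d1 _]/(val (fglift id (h i'))).
      by rewrite (fglift_sum_coeff _ (undup_uniq _) (hl i')) linear_sum.
    rewrite raddf_sum -sumrN.
    rewrite (sum_nth _ (fun z => - coeff z (h i') * coeff m`_j (val z))).
    by apply: eq_bigr => z _; rewrite /= coeffZ mulNr.
  apply/matrixP => i j; rewrite XP mxE; case: split => i'.
    rewrite mxE /q raddf_sum; apply: eq_bigr => c _.
    by rewrite mxE /= coeffZ coeffU mul1r.
  rewrite mxE; have -> : d1 (h i') = 0 by apply/ex2; exists (g i').
  by rewrite coeff0 oppr0.
- apply/rowP => c; rewrite !mxE.
  pose phi0 := tensor_lift
    (fun (b : A) (x : {freeg N / R}) => (b : D) * f (coeff l`_c x)).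
  have hphi : zmod_morphism phi0 := tensor_lift_additive (coeff_balanced l`_c).
  pose mphi := GRing.isZmodMorphism.Build _ _ phi0 hphi.
  pose phi : {additive tensor A {freeg N / R} -> D} := HB.pack phi0 mphi.
  have phiE b x : phi (tens b x) = (b : D) * f (coeff l`_c x).
    exact/tensor_lift_tens/coeff_balanced.
  have yaE : \sum_i y 0 i * f (n i == l`_c)%:R =
      \sum_i (a i : D) * f (coeff l`_c (h i)).
    transitivity (phi tau).
      rewrite raddf_sum; apply: eq_bigr => i _.
      by rewrite phiE coeffU mul1r.
    rewrite tauE sigmaE !raddf_sum; apply: eq_bigr => i _.
    by apply: etrans (phiE _ _); congr (phi _); exact: tensor_mapE.
  rewrite big_split_ord /=.
  under eq_bigr => i _ do rewrite row_mxEl !mxE (unsplitK (inl i)).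
  under [X in _ + X]eq_bigr => i _ do
    rewrite row_mxEr !mxE (unsplitK (inr i)) rmorphN mulrN.
  by rewrite sumrN yaE subrr.
apply/colP => c; rewrite !mxE.
have lc : l`_c \in l by exact: mem_nth.
have /eqP := valP l`_c;
  rewrite [e _](fglift_sum_coeff _ (undup_uniq _) (lm _ lc)).
by apply: etrans; rewrite -sum_nth; apply: eq_bigr => j _; rewrite !mxE.
Qed.
End TorCriterion.

(** * Kernel bases over the division ring *)

Lemma row_col_mx0 (R : pzSemiRingType) m n p q (A : 'M[R]_(m, n)) :
  row_mx (col_mx A 0) 0 = col_mx (row_mx A 0) 0 :> 'M_(m + p, n + q).
Proof. by rewrite -col_mx0 -block_mxEh block_mxEv row_mx0. Qed.

Section KernelBasisInjectivity.
Variables (R : nzRingType) (D : unitRingType) (f : {rmorphism R -> D}).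
Hypothesis tor : Tor1_eq0 (right_restriction f) (left_restriction f).
Hypothesis lsyz : stably_free_syzygies R (left_restriction f).
Hypothesis rsyz : stably_free_syzygies (R^c)%type (right_restriction f).

Lemma right_kernel_basis_inj t v k (y : 'rV[D]_t) (Q : 'M[R]_(t, v))
    (W : 'M[D]_(v, k)) :
  right_kernel_basis f y Q -> map_mx f Q *m W = 0 -> W = 0.
Proof.
move=> [yQ Qspan Qfree].
suff cV_inj (w : 'cV_v) : map_mx f Q *m w = 0 -> w = 0.
  move=> QW; apply: trmx_inj; apply/row_matrixP => j.
  rewrite -!tr_col col0; congr (_^T); apply: cV_inj.
  by rewrite colE mulmxA QW mul0mx.
move=> Qw.
have [u [s [P' [P'w P'span P'free]]]] := left_kernel_basis_cV lsyz w.
have [q [a [s1 [X [p [P [E [z [wE QE yX Pz]]]]]]]]] :=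
  Tor1_eq0_criterion tor yQ Qw.
(* L' is spanned by y and a, with relations [Q2]. [G] lifts the inclusion of L in L', and [Gw] says
   that the class of w dies in Tor_1(L', M). *)
have [u2 [v2 [Q2 [yQ2 Q2span Q2free]]]] :=
  right_kernel_basis_rV rsyz (row_mx y a).
have [|G GE] := Q2span _ (col_mx (col_mx Q 0) 0).
  by rewrite !map_col_mx !map_mx0 !mul_row_col !mulmx0 !addr0.
have [|V VE] := Q2span _ (col_mx X 0).
  by rewrite map_col_mx map_mx0 mul_row_col mulmx0 addr0.
have GEV : G *m E = V *m P.
  apply/eqP; rewrite -subr_eq0; apply/eqP/Q2free.
  by rewrite mulmxBr !mulmxA -GE -VE !mul_col_mx !mul0mx QE subrr.
have Gw : map_mx f G *m w = 0.
  by rewrite wE mulmxA -map_mxM GEV map_mxM -mulmxA Pz mulmx0.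
have [|G' G'E] := P'span _ (row_mx G 0).
  by rewrite map_row_mx map_mx0 mul_row_col Gw mulmx0 addr0.
have [|Q' Q'E] := P'span _ (row_mx Q 0).
  by rewrite map_row_mx map_mx0 mul_row_col Qw mulmx0 addr0.
(* Up to stabilisation, y Q' is the element of L (x) J attached to w, where J is free on the rows of
   [P']. Cancelling [P'] shows that it is zero. *)
have Q2G' : Q2 *m G' = col_mx (col_mx Q' 0) 0.
  apply/eqP; rewrite -subr_eq0; apply/eqP/P'free.
  rewrite mulmxBl -mulmxA -G'E mul_mx_row -GE mulmx0 !mul_col_mx !mul0mx -Q'E.
  by rewrite !row_col_mx0 subrr.
have yQ' : y *m map_mx f Q' = 0.
  have : row_mx (row_mx y a) 0 *m map_mx f (Q2 *m G') = 0.
    by rewrite map_mxM mulmxA yQ2 mul0mx.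
  by rewrite Q2G' !map_col_mx !map_mx0 !mul_row_col !mulmx0 !addr0.
have [V' V'E] := Qspan _ _ yQ'.
(* Cancelling [Q] makes every unit vector a relation among the entries of w, so w = 0. *)
have V'P' : V' *m P' = row_mx 1%:M 0.
  apply/eqP; rewrite -subr_eq0; apply/eqP/Qfree.
  by rewrite mulmxBr mulmxA -V'E -Q'E mul_mx_row mulmx1 mulmx0 subrr.
have -> : w = map_mx f (V' *m P') *m col_mx w 0.
  by rewrite V'P' map_row_mx map_mx1 map_mx0 mul_row_col mul1mx mul0mx addr0.
by rewrite map_mxM -mulmxA P'w mulmx0.
Qed.

(** [P] factors as [Q *m W] through the relations of y. Injectivity of [Q] over [D] puts the rows of
    [W] in the kernel of [Z], so [W = V *m P]; then [Q] has a right inverse although y kills it. *)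
Lemma left_kernel_basis_inj n k t (Z : 'M[D]_(n, k)) (P : 'M[R]_(t, n))
    (y : 'rV[D]_t) :
  left_kernel_basis f Z P -> y *m map_mx f P = 0 -> y = 0.
Proof.
move=> [PZ Pspan Pfree] yP.
have [u [v [Q Qbasis]]] := right_kernel_basis_rV rsyz y.
have [yQ Qspan _] := Qbasis.
have [|W WE] := Qspan _ (col_mx P 0).
  by rewrite map_col_mx map_mx0 mul_row_col yP mulmx0 addr0.
have [V VE] : exists V, W = V *m P.
  apply: Pspan; apply: (right_kernel_basis_inj Qbasis).
  rewrite mulmxA -map_mxM -WE map_col_mx map_mx0 mul_col_mx PZ mul0mx.
  by rewrite col_mx0.
have QV : usubmx Q *m V = 1%:M.
  apply/eqP; rewrite -subr_eq0; apply/eqP/Pfree.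
  rewrite mulmxBl mul1mx -mulmxA -VE; apply/eqP; rewrite subr_eq0; apply/eqP.
  by move: WE; rewrite -{1}[Q]vsubmxK mul_col_mx => /eq_col_mx[-> _].
move: yQ; rewrite -[Q]vsubmxK map_col_mx mul_row_col mul0mx addr0 => yQ.
by rewrite -[y]mulmx1 -(map_mx1 f) -QV map_mxM mulmxA yQ mul0mx.
Qed.

Lemma left_kernel_basis_cast n n' k t (e : n = n') (Z : 'M[D]_(n, k))
    (P : 'M[R]_(t, n)) :
  left_kernel_basis f Z P ->
  left_kernel_basis f (castmx (e, erefl) Z) (castmx (erefl, e) P).
Proof. by case: n' / e; rewrite !castmx_id. Qed.

(** The syzygy hypothesis treats one column, since it concerns submodules of [D]; further columns
    are added by induction. *)
Lemma left_kernel_basis_exists n k (Z : 'M[D]_(n, k)) :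
  exists s t (P : 'M[R]_(t, n + s)),
    left_kernel_basis f (col_mx Z (0 : 'M_(s, k))) P.
Proof.
elim: k n Z => [|k IH] n Z.
  exists 0%N, (n + 0)%N, 1%:M; split=> [|m X _|m C].
  - by rewrite [LHS]thinmx0.
  - by exists X; rewrite mulmx1.
  - by rewrite mulmx1.
pose z : 'M_(n, 1) := lsubmx (Z : 'M_(n, 1 + k)).
pose Z' : 'M_(n, k) := rsubmx (Z : 'M_(n, 1 + k)).
have ZE : Z = row_mx z Z' by rewrite hsubmxK.
have [s [t [P [Pz Pspan Pfree]]]] := left_kernel_basis_cV lsyz z.
have [s' [t' [P' [P'Z P'span P'free]]]] :=
  IH _ (map_mx f P *m col_mx Z' (0 : 'M_(s, k))).
(* Relations of the first column are C P. Imposing the other columns is a condition on C, with basis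
   [P']; the identity block carries the s' new free coordinates. *)
pose B : 'M[R]_(t + s', n + s + s') := block_mx P 0 0 1%:M.
pose Z0 : 'M_(n + s, 1 + k) := col_mx Z 0.
have Z0E : Z0 = row_mx (col_mx z 0) (col_mx Z' 0).
  by rewrite -block_mxEh block_mxEv row_mx0 -ZE.
have BZ : map_mx f B *m col_mx Z0 (0 : 'M_(s', 1 + k)) =
    row_mx 0 (col_mx (map_mx f P *m col_mx Z' (0 : 'M_(s, k))) 0).
  rewrite map_block_mx !map_mx0 mul_block_col !mul0mx mulmx0 !addr0.
  rewrite Z0E mul_mx_row Pz -(row_mx0 _ s' 1 k) -block_mxEv block_mxEh.
  by rewrite col_mx0.
have basis : left_kernel_basis f (col_mx Z0 (0 : 'M_(s', 1 + k))) (P' *m B).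
  split=> [|m X|m C].
  - by rewrite map_mxM -mulmxA BZ mul_mx_row mulmx0 P'Z row_mx0.
  - rewrite -[X]hsubmxK map_row_mx mul_row_col mulmx0 addr0 => XZ.
    have [|C CE] := Pspan _ (lsubmx X).
      move: XZ; rewrite Z0E mul_mx_row -(row_mx0 _ m 1 k).
      by move=> /eq_row_mx[].
    have XE : row_mx (lsubmx X) (rsubmx X) = row_mx C (rsubmx X) *m B.
      by rewrite mul_row_block !mulmx0 addr0 add0r mulmx1 -CE.
    have [|C' C'E] := P'span _ (row_mx C (rsubmx X)).
      have : map_mx f (row_mx C (rsubmx X) *m B) *m col_mx Z0 0 = 0.
        by rewrite -XE map_row_mx mul_row_col mulmx0 addr0.
      rewrite map_mxM -mulmxA BZ mul_mx_row mulmx0 -(row_mx0 _ m 1 k).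
      by move=> /eq_row_mx[].
    by exists C'; rewrite XE C'E mulmxA.
  rewrite mulmxA -[C *m P']hsubmxK mul_row_block !mulmx0 addr0 add0r mulmx1.
  rewrite -[RHS]row_mx0 => /eq_row_mx[/Pfree l0 r0].
  by apply: P'free; rewrite -[LHS]hsubmxK l0 r0 row_mx0.
exists (s + s')%N, t', (castmx (erefl, esym (addnA n s s'))
  (P' *m B)).
have := left_kernel_basis_cast (esym (addnA n s s')) basis.
by rewrite -col_mxA col_mx0.
Qed.
End KernelBasisInjectivity.

(** * Stable rank and rank over the division ring *)

(** The columns of [Z] span the kernel of [A]; the rows that kill it form the row space of [A],
    spanned by the first r rows of [M]. *)
Lemma mx_normal_form_kernel (D : unitRingType) m n (A : 'M[D]_(m, n)) r :
  mx_normal_form A r ->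
  exists (N : 'M[D]_(r, n)) (Z : 'M[D]_n), A *m Z = 0 /\
    forall t (X : 'M_(t, n)), X *m Z = 0 -> exists H, X = H *m N.
Proof.
move=> [L [M [_ rn _ [M' [MM' M'M]] ->]]].
exists (pid_mx r *m M), (M' *m copid_mx r); split=> [|t X].
  rewrite -!mulmxA (mulmxA M) MM' mul1mx mulmxBr mulmx1 pid_mx_id //.
  by rewrite subrr mulmx0.
rewrite mulmxA mulmxBr mulmx1 => /eqP; rewrite subr_eq0 => /eqP XM'.
exists (X *m M' *m pid_mx r).
rewrite mulmxA -(mulmxA (X *m M')) pid_mx_id // -XM'.
by rewrite -mulmxA M'M mulmx1.
Qed.

Lemma invertible_mx_rank (R : nzRingType) n (A : 'M[R]_n) s k :
  stably_finite R -> invertible_mx A -> factors_through (stabilize A s) k ->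
  (n + s <= k)%N.
Proof.
move=> sf [A' [AA' _]] [B [C BC]]; apply: (stably_finite_factors1 sf).
exists B, (C *m block_mx A' 0 0 1%:M).
rewrite mulmxA -BC mulmx_block !mulmx0 !mul0mx !addr0 add0r mulmx1 AA'.
by rewrite -scalar_mx_block.
Qed.

Section StableRank.
Variables (R : nzRingType) (D : unitRingType) (f : {rmorphism R -> D}).
Hypothesis divD : is_division_ring D.
Hypothesis tor : Tor1_eq0 (right_restriction f) (left_restriction f).
Hypothesis lsyz : stably_free_syzygies R (left_restriction f).
Hypothesis rsyz : stably_free_syzygies (R^c)%type (right_restriction f).

Lemma inner_rank_stabilize_leq m n (A : 'M[R]_(m, n)) r :
  mx_normal_form (map_mx f A) r ->
  exists s, (inner_rank (stabilize A s) <= r + s)%N.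
Proof.
move=> /mx_normal_form_kernel[N [Z [AZ Zspan]]].
have [s [t [P Pbasis]]] := left_kernel_basis_exists lsyz Z.
have [PZ Pspan _] := Pbasis.
(* The left n columns of [P] over [D] factor through r by [HE]; with the s others this maps the t
   independent rows injectively into [D]^(r + s). *)
have trs : (t <= r + s)%N.
  have [|H HE] := Zspan _ (lsubmx (map_mx f P)).
    by rewrite -[RHS]PZ -[map_mx f P in RHS]hsubmxK mul_row_col mulmx0 addr0.
  apply: (left_injective_mx_leq divD (A := row_mx H (rsubmx (map_mx f P)))).
  move=> y; rewrite mul_mx_row -[RHS]row_mx0 => /eq_row_mx[yH yP].
  apply: (left_kernel_basis_inj tor lsyz rsyz Pbasis).
  by rewrite -[map_mx f P]hsubmxK HE mul_mx_row mulmxA yH yP mul0mx row_mx0.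
exists s; apply: leq_trans trs; apply: (inner_rankP _).2.
have [|U UE] := Pspan _ (stabilize A s); last by exists U, P.
rewrite map_block_mx !map_mx0 mul_block_col AZ !mul0mx mulmx0 !addr0.
by rewrite col_mx0.
Qed.

(** Enlarging s by one raises the inner rank by at most one, so the bound at a single s persists to
    the limit. *)
Lemma stable_rank_leq (sf : stably_finite R) m n (A : 'M[R]_(m, n)) r :
  mx_normal_form (map_mx f A) r -> stable_rank A <= r%:Z.
Proof.
move=> /inner_rank_stabilize_leq[s rs].
have [_ [N limN]] := stable_rankP A sf.
have rsN : (inner_rank (stabilize A (s + N)) <= r + (s + N))%N.
  elim: N {limN} => [|N IH]; first by rewrite addn0.
  rewrite addnS -addn1; apply: leq_trans (inner_rank_stabilizeS _ _) _.
  by rewrite (addnA r) leq_add2r.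
by rewrite -(limN (s + N)%N) ?leq_addl // lerBlDr -PoszD lez_nat.
Qed.
End StableRank.

Lemma stably_finite_inj (R S : nzRingType) (f : {rmorphism R -> S}) :
  injective f -> stably_finite S -> stably_finite R.
Proof.
move=> f_inj sf n A B AB.
have : map_mx f (B *m A) = map_mx f 1%:M.
  by rewrite map_mxM map_mx1; apply: sf; rewrite -map_mxM AB map_mx1.
by move=> /matrixP BA; apply/matrixP => i j; apply: f_inj;
  have := BA i j; rewrite ![map_mx _ _ _ _]mxE.
Qed.

Theorem theorem2p4 (R : nzRingType) (D : unitRingType) (f : {rmorphism R -> D})
    (fractions_f : division_ring_of_fractions f)
    (tor_f : Tor1_eq0 (right_restriction f) (left_restriction f))
    (left_syzygies : stably_free_syzygies R (left_restriction f))
    (right_syzygies : stably_free_syzygies (R^c)%type (right_restriction f)) :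
  pseudo_sylvester_domain R /\ universal_division_ring_of_fractions f.
Proof.
have [[divD _] f_inj] := fractions_f.
have sfR : stably_finite R.
  exact: stably_finite_inj f_inj (division_ring_stably_finite divD).
split; [split=> // m n k A B AB | split=> // D' f' [divD' _] n A invA].
  have [r nfA] := mx_normal_form_exists divD (map_mx f A).
  have [r' nfB] := mx_normal_form_exists divD (map_mx f B).
  have rr' : (r + r' <= n)%N.
    by apply: (mx_normal_form_mul0 divD nfA nfB); rewrite -map_mxM AB map_mx0.
  apply: le_trans (_ : r%:Z + r'%:Z <= _); last by rewrite -PoszD lez_nat.
  by apply: lerD;
    apply: (stable_rank_leq divD tor_f left_syzygies right_syzygies).
have [r nfA] := mx_normal_form_exists divD (map_mx f A).
have [s rs] := inner_rank_stabilize_leq divD tor_f left_syzygies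
  right_syzygies nfA.
(* The optimal factorisation over [R] is pushed to [D'], where [A] is invertible and stable
   finiteness bounds its size from below by n + s. *)
have nr : (n <= r)%N.
  rewrite -(leq_add2r s); apply: leq_trans rs.
  apply: (invertible_mx_rank (division_ring_stably_finite divD') invA).
  have [[B [C BC]] _] := inner_rankP (stabilize A s).
  exists (map_mx f' B), (map_mx f' C).
  by rewrite -map_mxM -BC map_block_mx !map_mx0 map_mx1.
have [L [M [_ rn iL iM ->]]] := nfA.
have -> : r = n by apply/eqP; rewrite eqn_leq rn.
by rewrite pid_mx_1 mulmx1; exact: invertible_mxM.
Qed.
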